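(* The dual matching involution $\alpha\mapsto\overline{\alpha}$ of $\mathcal{P}_n$ acts on non-constant mappings by $\alpha=\Phi(K,R,i,k)\mapsto\overline{\alpha}=\Phi(R+1,K-1,i(\overline{\alpha}),k)$, where, modulo $t=|K|=|R|$: Case (1): if $0\notin K$ and $n-1\notin R$, then $i(\overline{\alpha})=1+k(1-i)$; Case (2): if $0\notin K$ and $n-1\in R$, then $i(\overline{\alpha})=1-ki$; Case (3): if $0\in K$ and $n-1\notin R$, then $i(\overline{\alpha})=k(1-i)$; Case (4): if $0\in K$ and $n-1\in R$, then $i(\overline{\alpha})=-ki$. Moreover, $\alpha$ is in Case (1) (respectively Case (4)) if and only if $\overline{\alpha}$ is in Case (1) (respectively Case (4)), and $\alpha$ is in Case (2) (respectively Case (3)) if and only if $\overline{\alpha}$ is in Case (3) (respectively Case (2)).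
   Context: Let $[n]=\{0,1,\dots,n-1\}$; $\mathcal{T}_n$ is the full transformation semigroup on $[n]$, with maps written on the right and composed left to right. A sequence $(a_0,\dots,a_t)$ from $[n]$ is cyclic if there is at most one subscript $i$ with $a_i>a_{i+1}$ (taking $t+1=0$), and anti-cyclic if its reverse is cyclic. $\mathcal{OP}_n$ (resp. $\mathcal{OR}_n$) is the set of $\alpha\in\mathcal{T}_n$ whose image list $(0\alpha,1\alpha,\dots,(n-1)\alpha)$ is cyclic (resp. anti-cyclic). $\mathcal{P}_n=\mathcal{OP}_n\cup\mathcal{OR}_n$ is a regular submonoid of $\mathcal{T}_n$. Coordinates: let $2\le t\le n$, let $K=\{a_0<a_1<\dots<a_{t-1}\}$ and $R=\{r_0<r_1<\dots<r_{t-1}\}$ be $t$-subsets of $[n]$, let $i$ be an integer modulo $t$ and $k\in\{1,-1\}$. For $0\le j\le t-1$ let $K_j$ be the cyclic interval $\{a_j,a_j+1,\dots,a_{j+1}-1\}$ (entries modulo $n$, subscripts modulo $t$); these sets partition $[n]$. $\Phi(K,R,i,k)$ is the mapping $\alpha$ with $x\alpha=r_{i+kj}$ for all $x\in K_j$ (subscripts modulo $t$). Each $\Phi(K,R,i,k)$ is a member of $\mathcal{P}_n$ of rank $t$, and every non-constant member of $\mathcal{P}_n$ is of this form; $K$ and $R$ are determined by $\alpha$ ($R$ is the range of $\alpha$, $K$ the set of initial points of its kernel classes). The case that a mapping $\Phi(K,R,i,k)$ is in is determined by its own pair $(K,R)$. For $A\subseteq[n]$, $A+1$ and $A-1$ denote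 $\{x\pm1 \bmod n : x\in A\}$. The natural matching involution on the non-constant members of $\mathcal{P}_n$ is $\alpha=\Phi(K,R,i,k)\mapsto\alpha'=\Phi(R,K,-ki,k)$; it is a well-defined involution and $\alpha'$ is an inverse of $\alpha$ ($\alpha\alpha'\alpha=\alpha$, $\alpha'\alpha\alpha'=\alpha'$). The dual matching involution $\alpha\mapsto\overline{\alpha}$ is the matching obtained by the same construction with the standard linear order on $[n]$ replaced by the reverse order. Explicitly, with $\gamma\in\mathcal{T}_n$ the reflection $x\gamma=n-1-x$, it is $\overline{\alpha}=\gamma(\gamma\alpha\gamma)'\gamma$. *)

(* Defs.v *)
From mathcomp Require Import all_boot all_order all_algebra.

Set Implicit Arguments.
Unset Strict Implicit.
Unset Printing Implicit Defensive.

Import GRing.Theory.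
Local Open Scope ring_scope.

Section Transformations.

Variable n : nat.

Definition transf := {ffun 'I_n -> 'I_n}.

(* Maps act on the right: the left factor is applied first. *)
Definition tcomp (a b : transf) : transf := [ffun x => b (a x)].

Definition reflection : transf := [ffun x => rev_ord x].

Definition nonconstant (a : transf) : bool :=
  [exists x, exists y, a x != a y].

(* [zip s (rot 1 s)] lists the cyclically consecutive pairs of s. *)
Definition cyclic_seq (s : seq 'I_n) : bool :=
  (count (fun p : 'I_n * 'I_n => (p.2 < p.1)%N) (zip s (rot 1 s)) <= 1)%N.

Definition anticyclic_seq (s : seq 'I_n) : bool := cyclic_seq (rev s).

Definition OP : {set transf} := [set a : transf | cyclic_seq (codom a)].
Definition OR : {set transf} := [set a : transf | anticyclic_seq (codom a)].
Definition OPR : {set transf} := OP :|: OR.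

(* The cyclic interval {a, a+1, ..., b-1} modulo n, for a != b: x belongs to
   it iff the forward distance from a to x is less than that from a to b. *)
Definition cyc_interval (a b : 'I_n) : {set 'I_n} :=
  [set x : 'I_n | ((x + (n - a)) %% n < (b + (n - a)) %% n)%N].

(* Subscripts modulo t are elements of 'Z_t, which is Z/t only for t > 1; all
   uses below carry that hypothesis.  [enum A] is increasing, so for #|A| = t
   [subscript d A j] is the j-th element of A; d is a junk default. *)
Definition subscript (t : nat) (d : 'I_n) (A : {set 'I_n}) (j : 'Z_t) : 'I_n :=
  nth d (enum A) j.

Definition block (t : nat) (d : 'I_n) (K : {set 'I_n}) (j : 'Z_t) :
    {set 'I_n} :=
  cyc_interval (subscript d K j) (subscript d K (j + 1)).

(* For 1 < t = #|K| the blocks partition 'I_n, so the j picked is the unique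
   one with x in K_j and the last branch is unreachable. *)
Definition Phi (t : nat) (K R : {set 'I_n}) (i : 'Z_t) (k : int) : transf :=
  [ffun x => if [pick j : 'Z_t | x \in block x K j] is Some j
             then subscript x R (i + k%:~R * j) else x].

Definition coordinates (t : nat) (K R : {set 'I_n}) (k : int) : bool :=
  [&& (2 <= t <= n)%N, #|K| == t, #|R| == t & k \in [:: 1; -1]].

Definition natural_match (a b : transf) : bool :=
  [exists K : {set 'I_n}, exists R : {set 'I_n}, exists i : 'Z_#|K|,
    has (fun k : int =>
           [&& coordinates #|K| K R k, a == Phi K R i k
             & b == Phi R K (- (k%:~R * i)) k])
        [:: 1; -1]].

(* The b matched to a non-constant member a of OPR exists and is unique: the
   coordinates of a are unique, except that for t = 2 both signs k describe
   the same a and the same b.  The value at other maps is irrelevant. *)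
Definition natural_inv (a : transf) : transf :=
  odflt a [pick b : transf | natural_match a b].

Definition dual_inv (a : transf) : transf :=
  let g := reflection in
  tcomp (tcomp g (natural_inv (tcomp (tcomp g a) g))) g.

Definition shift_up (A : {set 'I_n}) : {set 'I_n} := [set ordS x | x in A].
Definition shift_down (A : {set 'I_n}) : {set 'I_n} := [set ord_pred x | x in A].

Definition has_first (A : {set 'I_n}) : bool :=
  [exists x in A, nat_of_ord x == 0%N].
Definition has_last (A : {set 'I_n}) : bool :=
  [exists x in A, nat_of_ord x == n.-1].

Definition case1 (K R : {set 'I_n}) : bool := ~~ has_first K && ~~ has_last R.
Definition case2 (K R : {set 'I_n}) : bool := ~~ has_first K && has_last R.
Definition case3 (K R : {set 'I_n}) : bool := has_first K && ~~ has_last R.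
Definition case4 (K R : {set 'I_n}) : bool := has_first K && has_last R.

Definition in_case (c : {set 'I_n} -> {set 'I_n} -> bool) (a : transf) : Prop :=
  exists (t : nat) (K R : {set 'I_n}) (i : 'Z_t) (k : int),
    [/\ coordinates t K R k, a = Phi K R i k & c K R].

End Transformations.

(* Main.v *)
(* If c x is the number of elements of K that are at most x, taken modulo t,
   then x lies in K_(c x - 1), so Phi K R i k x = r_(i + k (c x - 1)).  Under
   the reflection the kernel points K become -K, the range R becomes n - 1 - R
   with its enumeration reversed, and c x becomes t - c x, plus one if 0 is in
   K.  Conjugation by the reflection therefore maps (K, R, i, k) to
   (-K, n - 1 - R, -1 - i + k (2 - [0 in K]), k), and conjugating, matching and
   conjugating again gives the four cases.  The matching is read off any
   coordinates, because they are unique up to the value of k in Z/t: x is in K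
   iff the map differs at x and x - 1, and at x in K the subscript jumps by k. *)
Require Import Defs.
From mathcomp Require Import all_boot all_order all_algebra.
From mathcomp Require Import zify ring.

Import GRing.Theory.
Local Open Scope ring_scope.

(** * Counting the elements of a set up to a point, and the blocks of a kernel *)

Definition rank_le {n : nat} (A : {set 'I_n}) (x : 'I_n) : nat :=
  count (fun a : 'I_n => (a <= x)%N) (enum A).

Lemma rank_le_max {n : nat} (A : {set 'I_n}) (x : 'I_n) :
  (rank_le A x <= #|A|)%N.
Proof. by rewrite /rank_le cardE count_size. Qed.

Lemma sorted_enum_set {n : nat} (A : {set 'I_n}) :
  sorted ltn (map val (enum A)).
Proof.
rewrite {1}/enum_mem -enumT sorted_map; apply: sorted_filter.
  by move=> x y z /=; exact: ltn_trans.
by rewrite -(@sorted_map _ _ val ltn) val_enum_ord iota_ltn_sorted.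
Qed.

(** The elements at most [x] form an initial segment of the increasing enumeration. *)
Lemma nth_enum_le {n : nat} (A : {set 'I_n}) (d x : 'I_n) (m : nat) :
  (m < #|A|)%N -> (nth d (enum A) m <= x)%N = (m < rank_le A x)%N.
Proof.
rewrite /rank_le cardE; move: (sorted_enum_set A).
elim: (enum A) m => [//|a s IHs] m /= ap.
have sP : sorted ltn (map val s) by apply: path_sorted ap.
case: (leqP a x) => ax; first by case: m => [//|m] /= ?; rewrite IHs.
have c0 : count (fun a : 'I_n => (a <= x)%N) s = 0%N.
  apply/eqP; rewrite -leqn0 leqNgt -has_count; apply/hasPn => b bs.
  have /allP/(_ _ (map_f val bs)) := order_path_min ltn_trans ap.
  by rewrite -ltnNge /=; apply: ltn_trans.
rewrite c0 ltn0; case: m => [_|m] /=; first by rewrite leqNgt ax.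
by move=> ms; rewrite IHs // c0.
Qed.

(** The extreme counts [0] and [t.+2] fall in the same class, so both select the last subscript. *)
Lemma val_subr1 {t : nat} (j : 'Z_t.+2) (c : nat) :
  (c <= t.+2)%N ->
  (j == c%:R - 1) = (j.+1 == c)%N || (j.+1 == t.+2)%N && (c == 0)%N.
Proof.
move=> ct; rewrite eq_sym subr_eq eq_sym -val_eqE /= Zp_nat /=.
have jt : (j < t.+2)%N := ltn_ord j.
rewrite (modn_small (isT : 1 < t.+2)%N) addn1.
have [jm|jm] := ltnP j.+1 t.+2.
  rewrite modn_small //; case: (ltnP c t.+2) => ct'.
    by rewrite modn_small //; lia.
  have -> : c = t.+2 by lia.
  by rewrite (modnn t.+2); lia.
have -> : j.+1 = t.+2 by lia.
rewrite modnn; case: (ltnP c t.+2) => ct'; first by rewrite modn_small //; lia.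
have -> : c = t.+2 by lia.
by rewrite (modnn t.+2) !eqxx.
Qed.

Lemma nth_enum_lt {n : nat} (A : {set 'I_n}) (d : 'I_n) (m p : nat) :
  (m < #|A|)%N -> (p < #|A|)%N ->
  (nth d (enum A) m < nth d (enum A) p)%N = (m < p)%N.
Proof.
have nth_mono i j : (i < j < #|A|)%N -> (nth d (enum A) i < nth d (enum A) j)%N.
  rewrite cardE => /andP[ij js]; have si := ltn_trans ij js.
  rewrite -!(nth_map d (d : nat) val) //.
  by apply: (sorted_ltn_nth ltn_trans); rewrite ?inE ?size_map ?sorted_enum_set.
move=> mA pA; case: (ltngtP m p) => [mp|pm|->]; last by rewrite ltnn.
  by rewrite nth_mono ?mp.
by apply/negbTE; rewrite -leqNgt ltnW // nth_mono ?pm.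
Qed.

Lemma forward_dist {n : nat} (a x : 'I_n) :
  ((x + (n - a)) %% n = if a <= x then x - a else x + n - a)%N.
Proof.
have := ltn_ord a; have := ltn_ord x; case: (leqP a x) => ax xn an.
  have -> : (x + (n - a) = x - a + n)%N by lia.
  by rewrite modnDr modn_small //; lia.
by rewrite modn_small; lia.
Qed.

Lemma mem_block {n t : nat} (d x : 'I_n) (K : {set 'I_n}) (j : 'Z_t) :
  (1 < t)%N -> #|K| = t ->
  (x \in block d K j) = (j == (rank_le K x)%:R - 1).
Proof.
case: t j => [|[|t]] // j _ Kt; rewrite inE.
rewrite val_subr1; last by rewrite -Kt rank_le_max.
have jt : (j < t.+2)%N := ltn_ord j.
have j1 : j + 1 = (j.+1 %% t.+2)%N :> nat.
  by rewrite /= (modn_small (isT : 1 < t.+2)%N) addn1.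
rewrite /subscript j1 !forward_dist.
have := rank_le_max K x; rewrite Kt.
have := @nth_enum_le n K d x; rewrite Kt => leP.
have := @nth_enum_lt n K d; rewrite Kt => ltP.
have xn := ltn_ord x.
(* A block other than the last is an ordinary interval from [a] up to, but excluding, [b]. *)
have [j1t|tj1] := ltnP j.+1 t.+2.
  rewrite modn_small //; move: (leP _ jt) (leP _ j1t) (ltP _ _ jt j1t).
  set a := nth d _ j; set b := nth d _ j.+1; rewrite ltnSn.
  have := ltn_ord b; case: (leqP a x); case: (leqP b x); case: (leqP a b); lia.
(* The last block wraps around through 0: it holds the points from the last element of [K] on and
   those before the first. *)
have jE : j = t.+1 :> nat by lia.
rewrite jE modnn.
move: (leP t.+1 (ltnSn _)) (leP 0%N isT) (ltP 0%N t.+1 isT (ltnSn _)).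
set a := nth d _ t.+1; set b := nth d _ 0%N; rewrite ltn0Sn.
have := ltn_ord a; case: (leqP a x); case: (leqP b x); case: (leqP a b); lia.
Qed.

Lemma Phi_at {n t : nat} (K R : {set 'I_n}) (i : 'Z_t) (k : int) (x : 'I_n) :
  (1 < t)%N -> #|K| = t ->
  Phi K R i k x = subscript x R (i + k%:~R * ((rank_le K x)%:R - 1)).
Proof.
move=> t1 Kt; rewrite ffunE; case: pickP => [j|noj].
  by rewrite mem_block // => /eqP->.
by have := noj ((rank_le K x)%:R - 1); rewrite mem_block // eqxx.
Qed.

(** * Subscripts modulo [t] *)

Section Subscript.

Context {n t : nat}.
Hypothesis t_gt1 : (1 < t)%N.
Implicit Types (A : {set 'I_n}) (j : 'Z_t) (d x : 'I_n).

Lemma ltn_ZpE j : (j < t)%N.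
Proof. by have := ltn_ord j; rewrite [X in (_ < X)%N]Zp_cast. Qed.

Lemma subscript_inj A d d' j j' :
  #|A| = t -> subscript d A j = subscript d' A j' -> j = j'.
Proof.
rewrite cardE => At; rewrite /subscript (set_nth_default d' d) ?At ?ltn_ZpE //.
by move/eqP; rewrite nth_uniq ?enum_uniq ?At ?ltn_ZpE // => /eqP/val_inj.
Qed.

Lemma mem_subscript A d j : #|A| = t -> subscript d A j \in A.
Proof. by move=> At; rewrite -mem_enum mem_nth // -cardE At ltn_ZpE. Qed.

Lemma subscript_default A d d' j :
  #|A| = t -> subscript d A j = subscript d' A j.
Proof.
by move=> At; apply: set_nth_default; rewrite -cardE At ltn_ZpE.
Qed.

Lemma subscript_surj A d x :
  #|A| = t -> x \in A -> exists j : 'Z_t, subscript d A j = x.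
Proof.
move=> At; rewrite -mem_enum => xA.
have xt : (index x (enum A) < t)%N by rewrite -At cardE index_mem.
exists (index x (enum A))%:R.
by rewrite /subscript val_Zp_nat // modn_small // nth_index.
Qed.

Lemma rank_le_subscript A d j :
  #|A| = t -> (rank_le A (subscript d A j))%:R - 1 = j.
Proof.
move=> At; have jt := ltn_ZpE j.
suff -> : rank_le A (subscript d A j) = j.+1.
  by rewrite mulrSr addrK natr_Zp.
have leP m := @nth_enum_le n A d (subscript d A j) m.
have := leP j; rewrite At leqnn => /(_ jt) jr.
have := rank_le_max A (subscript d A j); rewrite At => rt.
have [jt'|] := ltnP j.+1 t; last by lia.
have := leP j.+1; rewrite At => /(_ jt').
have := @nth_enum_lt n A d j j.+1; rewrite At ltnSn => /(_ jt jt').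
by rewrite -/(subscript d A j); lia.
Qed.

End Subscript.

Lemma rank_le_sum {n : nat} (A : {set 'I_n}) (x : 'I_n) :
  rank_le A x = (\sum_(a in A) (a <= x))%N.
Proof.
by rewrite /rank_le -sum1_count big_enum_cond big_mkcondr.
Qed.

(** Passing from [x - 1] to [x] adds only [x] itself to the count. At [x = 0] the predecessor is
    [n - 1], where the count is [t], which vanishes in ['Z_t]. *)
Lemma rank_le_pred {n t : nat} (A : {set 'I_n}) (x : 'I_n) :
  (1 < t)%N -> #|A| = t ->
  (rank_le A x)%:R = (rank_le A (ord_pred x))%:R + (x \in A)%:R :> 'Z_t.
Proof.
move=> t1 At.
have xA : (x \in A) = (\sum_(a in A) (a == x))%N :> nat.
  case: (boolP (x \in A)) => xA; last first.
    by rewrite big1 // => a aA; case: eqP => // ax; rewrite -ax aA in xA.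
  by rewrite (bigD1 x) //= eqxx big1 // => a /andP[_ /negbTE->].
rewrite -natrD xA !rank_le_sum.
have [x0|x0] := eqVneq (x : nat) 0%N; last first.
  congr (_%:R); rewrite -big_split; apply: eq_bigr => a _ /=.
  have := ltn_ord x; rewrite -val_eqE /= => xn.
  have -> : ((x + n).-1 %% n = x.-1)%N.
    have -> : ((x + n).-1 = x.-1 + n)%N by lia.
    by rewrite modnDr modn_small //; lia.
  by lia.
rewrite natrD.
have -> : (\sum_(a in A) (a <= ord_pred x) = t)%N.
  rewrite -At -sum1_card; apply: eq_bigr => a _ /=.
  by rewrite x0 modn_small; have := ltn_ord a; lia.
rewrite pchar_Zp // add0r; congr (_%:R); apply: eq_bigr => a _.
by rewrite -(inj_eq val_inj) /= x0 leqn0.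
Qed.

(** * Reflection and negation of subsets *)

Definition rev_set {n : nat} (A : {set 'I_n}) : {set 'I_n} :=
  [set rev_ord x | x in A].

(** Since [n - 1 - (x - 1) = n - x], this is [-A] modulo [n]. Reflecting a class that ends just
    before [b] gives a class that starts at [-b], so kernel points are negated, not reflected. *)
Definition neg_set {n : nat} (A : {set 'I_n}) : {set 'I_n} :=
  rev_set (shift_down A).

Lemma card_rev_set {n : nat} (A : {set 'I_n}) : #|rev_set A| = #|A|.
Proof. exact: card_imset rev_ord_inj. Qed.

Lemma card_neg_set {n : nat} (A : {set 'I_n}) : #|neg_set A| = #|A|.
Proof. by rewrite card_rev_set card_imset //; exact: ord_pred_inj. Qed.

(** A nonzero [a] in [A] is counted exactly once, because [n - a <= n - 1 - x] iff [x < a]; the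
    element 0 is counted on both sides. *)
Lemma rank_le_neg {n : nat} (A : {set 'I_n}) (x : 'I_n) :
  (rank_le (neg_set A) (rev_ord x) + rank_le A x = #|A| + has_first A)%N.
Proof.
have inj : injective (@rev_ord n \o @ord_pred n).
  by apply: inj_comp; [apply: rev_ord_inj | apply: ord_pred_inj].
rewrite !rank_le_sum /neg_set /rev_set /shift_down -imset_comp big_imset /=; last first.
  by move=> a b _ _; apply: inj.
have -> : has_first A = (\sum_(a in A) (a == 0 :> nat))%N :> nat.
  rewrite /has_first; case: existsP => [[a /andP[aA /eqP a0]]|noA].
    rewrite (bigD1 a) //= a0 eqxx big1 // => b /andP[_]; rewrite -val_eqE /= a0.
    by move/negbTE->.
  by rewrite big1 // => a aA; case: eqP => // a0; case: noA; exists a; rewrite aA a0.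
rewrite -sum1_card -!big_split; apply: eq_bigr => a _ /=.
have := ltn_ord a; have := ltn_ord x.
case: (nat_of_ord a) => [|m] xn an /=; first by rewrite modn_small; lia.
by rewrite modnDr modn_small; lia.
Qed.

Lemma enum_rev_set {n : nat} (A : {set 'I_n}) :
  enum (rev_set A) = map (@rev_ord n) (rev (enum A)).
Proof.
apply: (@irr_sorted_eq _ (relpre val ltn)).
- by move=> x y z /=; apply: ltn_trans.
- by move=> x /=; rewrite ltnn.
- by rewrite -sorted_map sorted_enum_set.
- rewrite sorted_map rev_sorted.
  have := sorted_enum_set A; rewrite sorted_map; apply: sub_sorted.
  by move=> x y /=; have := ltn_ord y; lia.
- move=> x; rewrite mem_enum.
  apply/imsetP/mapP => -[y yA ->]; exists y => //.
    by rewrite mem_rev mem_enum.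
  by rewrite mem_rev mem_enum in yA.
Qed.

(** Reversing the enumeration moves position [j] to [t - 1 - j], which is [-1 - j] modulo [t]. *)
Lemma subscript_rev {n t : nat} (A : {set 'I_n}) (d : 'I_n) (j : 'Z_t) :
  (1 < t)%N -> #|A| = t ->
  subscript d (rev_set A) (- 1 - j) = rev_ord (subscript d A j).
Proof.
case: t j => [|[|t]] // j _ At; have jt : (j < t.+2)%N := ltn_ord j.
have -> : - 1 - j = rev_ord j.
  apply: val_inj => /=; rewrite (modn_small (isT : 1 < t.+2)%N).
  rewrite modnDm subn1 /=.
  have -> : (t.+1 + (t.+2 - j) = t.+2 - j.+1 + t.+2)%N by lia.
  by rewrite modnDr modn_small //; lia.
have jE : rev_ord j = (t.+2 - j.+1)%N :> nat by [].
rewrite /subscript enum_rev_set jE.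
rewrite (nth_map d) ?size_rev -?cardE ?At; last by lia.
rewrite nth_rev -?cardE ?At; last by lia.
by congr (rev_ord (nth _ _ _)); lia.
Qed.

(** Modulo [n], [-(n - 1 - x) = x + 1]; this is the source of [R + 1] in the dual, as [rev_neg_set]
    is of [K - 1]. *)
Lemma neg_rev_set {n : nat} (A : {set 'I_n}) : neg_set (rev_set A) = shift_up A.
Proof.
rewrite /neg_set /rev_set /shift_down /shift_up -!imset_comp.
apply: eq_imset => x /=; apply: val_inj => /=; have := ltn_ord x.
have [xn|nx] := ltnP x.+1 n => xn'; last first.
  have -> : x.+1 = n by lia.
  by rewrite modnn subnn add0n modn_small; lia.
rewrite (modn_small xn).
have -> : ((n - x.+1 + n).-1 = n - x.+2 + n)%N by lia.
by rewrite modnDr modn_small; lia.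
Qed.

Lemma rev_neg_set {n : nat} (A : {set 'I_n}) : rev_set (neg_set A) = shift_down A.
Proof.
rewrite /neg_set /rev_set -imset_comp -[RHS]imset_id.
by apply: eq_imset => x /=; rewrite rev_ordK.
Qed.

Lemma has_first_rev_set {n : nat} (A : {set 'I_n}) :
  has_first (rev_set A) = has_last A.
Proof.
apply/existsP/existsP => -[x /andP[xA /eqP xe]].
  case/imsetP: xA xe => y yA -> /= yn; exists y; rewrite yA.
  by apply/eqP; have := ltn_ord y; lia.
exists (rev_ord x); rewrite imset_f //=.
by have := ltn_ord x; lia.
Qed.

Lemma has_last_shift_down {n : nat} (A : {set 'I_n}) :
  has_last (shift_down A) = has_first A.
Proof.
rewrite -has_first_rev_set -/(neg_set A).
apply/existsP/existsP => -[x /andP[xA /eqP xe]].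
  case/imsetP: xA xe => _ /imsetP[y yA ->] -> /= yn; exists y; rewrite yA.
  have yl := ltn_ord y; rewrite eqn0Ngt; apply/negP => y0.
  move: yn; have -> : ((y + n).-1 = y.-1 + n)%N by lia.
  by rewrite modnDr modn_small; lia.
exists (rev_ord (ord_pred x)); rewrite !imset_f //= xe add0n.
have xn := ltn_ord x.
have -> : (n.-1 %% n = n.-1)%N by rewrite modn_small; lia.
lia.
Qed.

Lemma has_first_shift_up {n : nat} (A : {set 'I_n}) :
  has_first (shift_up A) = has_last A.
Proof.
by rewrite -neg_rev_set has_first_rev_set has_last_shift_down has_first_rev_set.
Qed.

(** * Uniqueness of coordinates and the natural matching *)

Lemma coordinatesP {n t : nat} {K R : {set 'I_n}} {k : int} :
  coordinates t K R k ->
  [/\ (1 < t)%N, #|K| = t, #|R| = t & (k%:~R : 'Z_t) * k%:~R = 1].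
Proof.
case/and4P => /andP[t1 _] /eqP Kt /eqP Rt kP; split=> //.
by move: kP; rewrite !inE => /orP[]/eqP->; rewrite ?mulrNN mulr1.
Qed.

Lemma coordinates_swap {n t : nat} {K R : {set 'I_n}} {k : int} :
  coordinates t K R k -> coordinates t R K k.
Proof. by case/and4P => ? ? ? ?; apply/and4P. Qed.

Lemma coordinates_neg_rev {n t : nat} {K R : {set 'I_n}} {k : int} :
  coordinates t K R k -> coordinates t (neg_set K) (rev_set R) k.
Proof. by rewrite /coordinates card_neg_set card_rev_set. Qed.

(** By [rank_le_pred] the subscript of the value changes by [k] between [x - 1] and [x] if [x] is in
    [K], and stays the same otherwise; [k] is nonzero in ['Z_t] because [k * k = 1]. *)
Lemma mem_Phi_domain {n t : nat} {K R : {set 'I_n}} {k : int} (i : 'Z_t) x :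
  coordinates t K R k ->
  (x \in K) = (Phi K R i k x != Phi K R i k (ord_pred x)).
Proof.
move=> /coordinatesP[t1 Kt Rt kk]; rewrite !Phi_at // (rank_le_pred K x t1 Kt).
case: (x \in K); last first.
  by rewrite addr0 (subscript_default t1 R x (ord_pred x)) ?eqxx.
apply/esym/eqP => /(subscript_inj t1 _ _ _ _ _ Rt)/addrI/(congr1 ( *%R k%:~R)).
rewrite !mulrA kk !mul1r => /addIr/eqP.
by rewrite -subr_eq0 addrC addKr oner_eq0.
Qed.

Lemma mem_Phi_range {n t : nat} {K R : {set 'I_n}} {k : int} (i : 'Z_t) y :
  coordinates t K R k -> (y \in R) = (y \in codom (Phi K R i k)).
Proof.
move=> /coordinatesP[t1 Kt Rt kk]; apply/idP/codomP => [yR|[x ->]]; last first.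
  by rewrite Phi_at // mem_subscript.
have [j <-] := subscript_surj t1 R y y Rt yR.
(* As [k] is its own inverse, [i + k * m = j] has the solution [m = k * (j - i)]. *)
exists (subscript y K (k%:~R * (j - i))).
rewrite Phi_at // rank_le_subscript // mulrA kk mul1r addrCA subrr addr0.
exact: subscript_default.
Qed.

Lemma Phi_inj_sets {n t t' : nat} {K R K' R' : {set 'I_n}} {k k' : int}
    (i : 'Z_t) (i' : 'Z_t') :
  coordinates t K R k -> coordinates t' K' R' k' ->
  Phi K R i k = Phi K' R' i' k' -> K = K' /\ R = R'.
Proof.
move=> co co' e; split; apply/setP => x.
  by rewrite (mem_Phi_domain i x co) (mem_Phi_domain i' x co') e.
by rewrite (mem_Phi_range i x co) (mem_Phi_range i' x co') e.
Qed.

(** The values at the elements of [K] compare [i + k * j] with [i' + k' * j]; then [j = 0] and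
    [j = 1] suffice. The sign is recovered only in ['Z_t], where [1 = -1] if [t = 2]. *)
Lemma Phi_inj_coef {n t : nat} {K R : {set 'I_n}} {k k' : int} (i i' : 'Z_t) :
  coordinates t K R k -> Phi K R i k = Phi K R i' k' ->
  i = i' /\ (k%:~R : 'Z_t) = k'%:~R.
Proof.
move=> /coordinatesP[t1 Kt Rt _] e.
have [d _] : exists d, d \in K by apply/card_gt0P; rewrite Kt ltnW.
have eqj j : i + k%:~R * j = i' + k'%:~R * j.
  have /ffunP/(_ (subscript d K j)) := e.
  by rewrite !Phi_at // rank_le_subscript // => /(subscript_inj t1 _ _ _ _ _ Rt).
have ii : i = i' by have := eqj 0; rewrite !mulr0 !addr0.
by split=> //; have := eqj 1; rewrite !mulr1 ii => /addrI.
Qed.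

Lemma eq_Phi_sign {n t : nat} (K R : {set 'I_n}) (i : 'Z_t) (k k' : int) :
  (k%:~R : 'Z_t) = k'%:~R -> Phi K R i k = Phi K R i k'.
Proof. by move=> e; apply/ffunP => x; rewrite !ffunE e. Qed.

Lemma natural_inv_Phi {n t : nat} {K R : {set 'I_n}} {k : int} (i : 'Z_t) :
  coordinates t K R k ->
  natural_inv (Phi K R i k) = Phi R K (- (k%:~R * i)) k.
Proof.
(* The index in [natural_match] has type ['Z_#|K|], so [t] is replaced by [#|K|]. *)
move=> co; have [_ Kt _ _] := coordinatesP co; subst t.
have kP : k \in [:: 1; -1] by case/and4P: co.
rewrite /natural_inv; case: pickP => [b|nob] /=; last first.
  have /negP[] := negbT (nob (Phi R K (- (k%:~R * i)) k)).
  apply/existsP; exists K; apply/existsP; exists R; apply/existsP; exists i.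
  by apply/hasP; exists k; rewrite // co !eqxx.
case/existsP => K' /existsP[R' /existsP[i' /hasP[k' _]]].
case/and3P => co' /eqP e /eqP ->.
have [? ?] := Phi_inj_sets i i' co co' e; subst K' R'.
by have [<- kk'] := Phi_inj_coef i i' co e; rewrite -kk'; apply: eq_Phi_sign.
Qed.

(* [in_case (fun _ _ => true) a] says that a is some Phi K R i k. *)
Lemma coordinates_or_natural_inv_id {n : nat} (a : transf n) :
  in_case (fun _ _ => true) a \/ natural_inv a = a.
Proof.
rewrite /natural_inv; case: pickP => [b|_]; last by right.
case/existsP => K /existsP[R /existsP[i /hasP[k _ /and3P[co /eqP-> _]]]].
by left; exists #|K|, K, R, i, k.
Qed.

(** * Conjugation by the reflection and the dual matching *)

Definition reflect_conj {n : nat} (a : transf n) : transf n :=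
  tcomp (tcomp (reflection n) a) (reflection n).

Lemma reflect_conjE {n : nat} (a : transf n) x :
  reflect_conj a x = rev_ord (a (rev_ord x)).
Proof. by rewrite /reflect_conj /tcomp !ffunE. Qed.

Lemma reflect_conjK {n : nat} : involutive (@reflect_conj n).
Proof. by move=> a; apply/ffunP => x; rewrite !reflect_conjE !rev_ordK. Qed.

Lemma reflect_conj_Phi {n t : nat} {K R : {set 'I_n}} {k : int} (i : 'Z_t) :
  coordinates t K R k ->
  reflect_conj (Phi K R i k) =
    Phi (neg_set K) (rev_set R)
        (- 1 - i + k%:~R * (2%:R - (has_first K)%:R)) k.
Proof.
move=> /coordinatesP[t1 Kt Rt _]; apply/ffunP => x.
rewrite reflect_conjE !Phi_at ?card_neg_set // -subscript_rev //.
rewrite (subscript_default t1 _ _ x) ?card_rev_set //; congr subscript.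
(* With [e] for [has_first K] and [c'] for the count of [neg_set K] at [x], the count of [K] at
   [rev_ord x] is [e - c'] modulo [t], and [-1 - (i + k (e - c' - 1)) = (-1 - i + k (2 - e)) + k (c'
   - 1)]. *)
have := rank_le_neg K (rev_ord x); rewrite rev_ordK Kt.
move/(congr1 (fun m => m%:R : 'Z_t)); rewrite !natrD pchar_Zp // add0r.
move/(canRL (addKr _)) ->; ring.
Qed.

(** One formula covers the four cases, with the two membership tests as 0 or 1 in ['Z_t]. The term
    [k (2 - has_first K)] of the first conjugation loses its [k] in the matching, as [k * k = 1];
    the second conjugation contributes [k (2 - has_last R)]. *)
Lemma dual_inv_Phi {n t : nat} {K R : {set 'I_n}} {k : int} (i : 'Z_t) :
  coordinates t K R k ->
  dual_inv (Phi K R i k) =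
    Phi (shift_up R) (shift_down K)
        (1 - (has_first K)%:R + k%:~R * (1 - (has_last R)%:R) - k%:~R * i) k.
Proof.
move=> co; have [_ _ _ kk] := coordinatesP co.
rewrite /dual_inv -!/(reflect_conj _) (reflect_conj_Phi i co).
have co' := coordinates_neg_rev co.
rewrite natural_inv_Phi // (reflect_conj_Phi _ (coordinates_swap co')).
rewrite neg_rev_set rev_neg_set has_first_rev_set; congr Phi.
rewrite mulrDr mulrA kk; ring.
Qed.

(** Where nothing matches, [natural_inv] is the identity by its default, and conjugation by the
    reflection preserves having coordinates. This allows a case of [dual_inv a] to be traced back to
    [a]. *)
Lemma coordinates_or_dual_inv_id {n : nat} (a : transf n) :
  in_case (fun _ _ => true) a \/ dual_inv a = a.
Proof.
rewrite /dual_inv -!/(reflect_conj _).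
have [[t [K [R [i [k [co aE _]]]]]]|->] := coordinates_or_natural_inv_id (reflect_conj a).
  left; rewrite -(reflect_conjK a) aE (reflect_conj_Phi i co).
  by do 5 eexists; split; first exact: coordinates_neg_rev co.
by right; rewrite reflect_conjK.
Qed.

(** * The four cases under the dual matching *)

Lemma coordinates_shift {n t : nat} {K R : {set 'I_n}} {k : int} :
  coordinates t K R k -> coordinates t (shift_up R) (shift_down K) k.
Proof.
rewrite /coordinates !card_imset; [|exact: ord_pred_inj|exact: ordS_inj].
exact: coordinates_swap.
Qed.

Lemma in_case_Phi {n t : nat} {K R : {set 'I_n}} {k : int} (i : 'Z_t)
    (c : {set 'I_n} -> {set 'I_n} -> bool) :
  coordinates t K R k -> in_case c (Phi K R i k) <-> c K R.
Proof.
move=> co; split=> [|cKR]; last by exists t, K, R, i, k.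
case=> t' [K' [R' [i' [k' [co' e cKR]]]]].
by have [-> ->] := Phi_inj_sets i i' co co' e.
Qed.

Lemma in_case_dual {n : nat} (c c' : {set 'I_n} -> {set 'I_n} -> bool)
    (a : transf n) :
  (forall K R, c' (shift_up R) (shift_down K) = c K R) ->
  in_case c a <-> in_case c' (dual_inv a).
Proof.
move=> cc'.
have in_case_dual_Phi (t : nat) K R (i : 'Z_t) k :
    coordinates t K R k ->
    in_case c (Phi K R i k) <-> in_case c' (dual_inv (Phi K R i k)).
  move=> co; rewrite (dual_inv_Phi i co) (in_case_Phi _ _ co).
  by rewrite (in_case_Phi _ _ (coordinates_shift co)) cc'.
split=> [ca|c'a].
  have [t [K [R [i [k [co aE _]]]]]] := ca.
  by move: ca; rewrite aE; move/in_case_dual_Phi; apply.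
(* The hypothesis gives coordinates of [dual_inv a], while those of [a] are wanted; if [a] had none,
   then [dual_inv a = a]. *)
suff [t [K [R [i [k [co aE _]]]]]] : in_case (fun _ _ => true) a.
  by move: c'a; rewrite aE; move/in_case_dual_Phi; apply.
have [//|aE] := coordinates_or_dual_inv_id a.
have [t [K [R [i [k [co dE _]]]]]] := c'a.
by exists t, K, R, i, k; rewrite -aE.
Qed.

Theorem theorem3p2p2 (n : nat) (alpha : transf n)
    (alphaP : alpha \in OPR n) (alpha_nc : nonconstant alpha) :
  (forall (t : nat) (K R : {set 'I_n}) (i : 'Z_t) (k : int),
     coordinates t K R k -> alpha = Phi K R i k ->
     [/\ case1 K R ->
           dual_inv alpha
             = Phi (shift_up R) (shift_down K) (1 + k%:~R * (1 - i)) k,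
         case2 K R ->
           dual_inv alpha
             = Phi (shift_up R) (shift_down K) (1 - k%:~R * i) k,
         case3 K R ->
           dual_inv alpha
             = Phi (shift_up R) (shift_down K) (k%:~R * (1 - i)) k
       & case4 K R ->
           dual_inv alpha
             = Phi (shift_up R) (shift_down K) (- (k%:~R * i)) k])
  /\
  [/\ in_case (@case1 n) alpha <-> in_case (@case1 n) (dual_inv alpha),
      in_case (@case4 n) alpha <-> in_case (@case4 n) (dual_inv alpha),
      in_case (@case2 n) alpha <-> in_case (@case3 n) (dual_inv alpha)
    & in_case (@case3 n) alpha <-> in_case (@case2 n) (dual_inv alpha)].
Proof.
split=> [t K R i k co ->|].
  rewrite (dual_inv_Phi i co).
  by split=> /andP[]; do 2 ?[move/negbTE-> | move->]; rewrite ?mulr0n ?mulr1n; congr Phi; ring.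
(* 0 is in [R + 1] iff [n - 1] is in [R], and [n - 1] is in [K - 1] iff 0 is in [K]. The two tests
   are thus exchanged, which fixes Cases (1) and (4) and swaps (2) with (3). *)
by split; apply: in_case_dual => K R;
   rewrite /case1 /case2 /case3 /case4 has_first_shift_up has_last_shift_down andbC.
Qed.
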